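(* Let $N \ge 1$ and let $\Delta^{N-1} = \{\boldsymbol{\pi} \in \mathbb{R}^N : \pi_i \ge 0 \text{ for all } i,\ \sum_{i=1}^N \pi_i = 1\}$ be the probability simplex. Define the flow sparsity loss $\mathcal{L}_{flow} : \Delta^{N-1} \to \mathbb{R}$ by $\mathcal{L}_{flow}(\boldsymbol{\pi}) = -\sum_{i=1}^N \pi_i \log \pi_i$. Then the global minima of $\mathcal{L}_{flow}$ over $\Delta^{N-1}$ lie exclusively at the vertices of $\Delta^{N-1}$; that is, every global minimizer of $\mathcal{L}_{flow}$ on $\Delta^{N-1}$ is one of the standard basis vectors $\mathbf{e}_1, \dots, \mathbf{e}_N$.
   Context: The convention $0 \log 0 = 0$ is used. The vertices of $\Delta^{N-1}$ are the standard basis vectors $\mathbf{e}_1,\dots,\mathbf{e}_N$ of $\mathbb{R}^N$ (one-hot distributions). *)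

(* Defs.v *)
From mathcomp Require Import all_boot all_order all_algebra.
From mathcomp Require Import classical_sets reals exp.

Set Implicit Arguments.
Unset Strict Implicit.
Unset Printing Implicit Defensive.

Import Order.TTheory GRing.Theory Num.Theory.
Local Open Scope classical_set_scope.
Local Open Scope ring_scope.

Definition simplex (R : realType) (N : nat) : set 'rV[R]_N :=
  [set p | (forall i, 0 <= p 0 i) /\ \sum_(i < N) p 0 i = 1].

(* The convention 0 log 0 = 0 needs no case distinction: [ln] is total, so
   [0 * ln 0 = 0]. *)
Definition flow_loss (R : realType) (N : nat) (p : 'rV[R]_N) : R :=
  - \sum_(i < N) p 0 i * ln (p 0 i).

Definition global_minimizer (R : realType) (T : Type) (D : set T) (f : T -> R)
    (x : T) : Prop :=
  D x /\ forall y, D y -> f x <= f y.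

(* Main.v *)
(** Each summand [- p_i ln p_i] is nonnegative on the simplex and vanishes only
    for [p_i] equal to 0 or 1, while the loss is 0 at the vertices.  So the
    coordinates of a minimizer are all 0 or 1, and they sum to 1. *)
Require Import Defs.
From mathcomp Require Import all_boot all_order all_algebra.
From mathcomp Require Import classical_sets reals exp.

Import Order.TTheory GRing.Theory Num.Theory.
Local Open Scope ring_scope.

Lemma delta_mx_simplex (R : realType) (N : nat) (i : 'I_N) :
  @simplex R N (delta_mx 0 i).
Proof.
split=> [j|]; first by rewrite mxE ler0n.
rewrite (bigD1 i) //= big1 ?addr0 => [|j ji]; first by rewrite mxE !eqxx.
by rewrite mxE (negbTE ji) andbF.
Qed.

Lemma flow_loss_delta_mx (R : realType) (N : nat) (i : 'I_N) :
  @flow_loss R N (delta_mx 0 i) = 0.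
Proof.
rewrite /flow_loss big1 ?oppr0 // => j _; rewrite mxE eqxx /=.
(* Each summand is either [1 * ln 1] or [0 * ln 0]; the second vanishes whatever [ln 0] is. *)
by case: (j == i); rewrite ?ln1 ?mulr0 ?mul0r.
Qed.

Lemma simplex_le1 (R : realType) (N : nat) (p : 'rV[R]_N) (i : 'I_N) :
  simplex p -> p 0 i <= 1.
Proof.
by case=> p0 <-; rewrite (bigD1 i) //= lerDl sumr_ge0.
Qed.

(** The remaining coordinates are nonnegative and sum to 0, so each of them vanishes. *)
Lemma simplex_coord1 (R : realType) (N : nat) (p : 'rV[R]_N) (i : 'I_N) :
  simplex p -> p 0 i = 1 -> p = delta_mx 0 i.
Proof.
case=> p0 p1 pi1; apply/rowP => j; rewrite mxE eqxx /=.
have [->|ji] := eqVneq j i; first by [].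
move: p1; rewrite (bigD1 i) //= pi1 -[RHS]addr0 => /addrI p1.
exact: (psumr_eq0P (fun k _ => p0 k) p1).
Qed.

Lemma mulr_ln_le0 (R : realType) (x : R) : x <= 1 -> 0 <= x -> x * ln x <= 0.
Proof. by move=> x1 x0; rewrite mulr_ge0_le0 // ln_le0. Qed.

Lemma flow_loss_le0_coord (R : realType) (N : nat) (p : 'rV[R]_N) (i : 'I_N) :
  simplex p -> flow_loss p <= 0 -> p 0 i != 0 -> p 0 i = 1.
Proof.
move=> sp; have [p0 _] := sp; rewrite /flow_loss -sumrN => le0 pi0.
have term_ge0 j : true -> 0 <= - (p 0 j * ln (p 0 j)).
  by rewrite oppr_ge0 mulr_ln_le0 // simplex_le1.
have sum0 : \sum_(j < N) - (p 0 j * ln (p 0 j)) = 0.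
  by apply/eqP; rewrite eq_le le0 sumr_ge0.
have /eqP : - (p 0 i * ln (p 0 i)) = 0 by exact: (psumr_eq0P term_ge0 sum0).
(* Since [p 0 i] is nonzero, the factor [ln (p 0 i)] vanishes; on positive reals [ln] has 1 as its
   only zero. *)
rewrite oppr_eq0 mulf_eq0 (negbTE pi0) /= ln_eq0 ?lt0r ?pi0 ?p0 //.
by move/eqP.
Qed.

Theorem theorem2p1 (R : realType) (N : nat) (hN : (1 <= N)%N) (p : 'rV[R]_N) :
  global_minimizer (@simplex R N) (@flow_loss R N) p ->
  exists i : 'I_N, p = delta_mx 0 i.
Proof.
case=> sp minp.
have le0 : flow_loss p <= 0.
  (* [hN] supplies index 0, hence a vertex of loss 0 to compare [p] with; any other vertex would
     serve. *)
  by rewrite -(flow_loss_delta_mx R N (Ordinal hN)); exact/minp/delta_mx_simplex.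
have [i pi0|all0] := pickP (fun i => p 0 i != 0).
  by exists i; apply: simplex_coord1 => //; exact: flow_loss_le0_coord.
(* If all coordinates were 0, their sum would be 0 and not 1. *)
have [_ /eqP] := sp; rewrite big1 ?(eq_sym 0) ?oner_eq0 // => i _.
by apply/eqP/negbFE/all0.
Qed.
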